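(* Let $S\subseteq\mathbb{N}^2$ be a good semigroup and let $T=T((\boldsymbol{\alpha_1},\dots,\boldsymbol{\alpha_n}))$ be a track in $S$. Then $S'=S\setminus T$ is a good semigroup strictly contained in $S$. (Good semigroups are here identified with their semirings, i.e. $\Gamma_S\setminus T=\Gamma_{S'}$ for a good semigroup $S'\subsetneq S$ of $\mathbb{N}^2$.)
   Context: $\mathbb{N}=\{0,1,2,\dots\}$. A submonoid $S$ of $(\mathbb{N}^2,+)$ is a good semigroup if: (G1) $\boldsymbol{\alpha},\boldsymbol{\beta}\in S$ implies $\min(\boldsymbol{\alpha},\boldsymbol{\beta})=(\min\{\alpha_1,\beta_1\},\min\{\alpha_2,\beta_2\})\in S$; (G2) there is $\boldsymbol{\delta}\in\mathbb{N}^2$ with $\boldsymbol{\delta}+\mathbb{N}^2\subseteq S$; (G3) if $\boldsymbol{\alpha},\boldsymbol{\beta}\in S$, $\boldsymbol{\alpha}\ne\boldsymbol{\beta}$ and $\alpha_i=\beta_i$ for some $i$, then there is $\boldsymbol{\epsilon}\in S$ with $\epsilon_i>\alpha_i=\beta_i$ and $\epsilon_j\ge\min\{\alpha_j,\beta_j\}$ for $j\neq i$, with equality if $\alpha_j\ne\beta_j$. Good semigroups are always assumed local: if $\boldsymbol{\alpha}\in S$ has a zero coordinate, then $\boldsymbol{\alpha}=\boldsymbol{0}$. Let $\overline{\mathbb{N}}=\mathbb{N}\cup\{\infty\}$ with $a<\infty$ for $a\in\mathbb{N}$ and $x+\infty=\infty$ for all $x$. Put $S_1^\infty=\{(a,\infty):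 a\in\mathbb{N},\ \exists\,\tilde y\ \forall y\ge\tilde y,\ (a,y)\in S\}$, $S_2^\infty=\{(\infty,b): b\in\mathbb{N},\ \exists\,\tilde x\ \forall x\ge\tilde x,\ (x,b)\in S\}$, $S^\infty=S_1^\infty\cup S_2^\infty\cup\{(\infty,\infty)\}$, $\Gamma_S=S\cup S^\infty$. Write $\boldsymbol{\alpha}\oplus\boldsymbol{\beta}$ for the componentwise minimum. Throughout, $S$ is identified with $\Gamma_S$, i.e. infinite elements are treated as elements of $S$. $\boldsymbol{\alpha}\in\Gamma_S\setminus\{\boldsymbol{0}\}$ is irreducible if $\boldsymbol{\alpha}=\boldsymbol{\beta}+\boldsymbol{\gamma}$ with $\boldsymbol{\beta},\boldsymbol{\gamma}\in\Gamma_S$ implies $\boldsymbol{\alpha}=\boldsymbol{\beta}$ or $\boldsymbol{\alpha}=\boldsymbol{\gamma}$; $I(S)$ is the set of irreducible elements. For $\boldsymbol{\alpha}\in\mathbb{N}^2$ and $\{i,j\}=\{1,2\}$ let $\Delta_i(\boldsymbol{\alpha})=\{\boldsymbol{\beta}\in\mathbb{Z}^2:\beta_i=\alpha_i,\ \beta_j>\alpha_j\}$, $\Delta(\boldsymbol{\alpha})=\Delta_1(\boldsymbol{\alpha})\cup\Delta_2(\boldsymbol{\alpha})$, ${}_i\Delta(\boldsymbol{\alpha})=\{\boldsymbol{\beta}\in\mathbb{Z}^2:\beta_i=\alpha_i,\ \beta_j<\alpha_j\}$; also ${}_1\Delta((a,\infty))=\{\boldsymbol{\beta}\in\mathbb{Z}^2:\beta_1=a\}$,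 ${}_2\Delta((a,\infty))=\emptyset$, ${}_1\Delta((\infty,b))=\emptyset$, ${}_2\Delta((\infty,b))=\{\boldsymbol{\beta}\in\mathbb{Z}^2:\beta_2=b\}$. A superscript $S$ denotes intersection with $S$. $\boldsymbol{\alpha}\in\Gamma_S$ is absolute if $\boldsymbol{\alpha}\in S^\infty$, or $\boldsymbol{\alpha}\in S\cap\mathbb{N}^2$ and $\Delta^S(\boldsymbol{\alpha})=\emptyset$. $I_A(S)$ is the set of irreducible absolute elements of $\Gamma_S$. Two elements $\boldsymbol{\alpha},\boldsymbol{\beta}\in I_A(S)$ are connected by a piece of track if they are incomparable for the componentwise order and, with $\boldsymbol{\gamma}=\boldsymbol{\alpha}\oplus\boldsymbol{\beta}$, $\Delta^S(\boldsymbol{\gamma})\cap(S\setminus I(S))=\emptyset$. Elements $\boldsymbol{\alpha_1},\dots,\boldsymbol{\alpha_n}\in I_A(S)$ ($n\ge1$) with strictly increasing first coordinates are connected by a track if ${}_2\Delta^S(\boldsymbol{\alpha_1})\cap(S\setminus I(S))=\emptyset$, ${}_1\Delta^S(\boldsymbol{\alpha_n})\cap(S\setminus I(S))=\emptyset$, and $\boldsymbol{\alpha_i},\boldsymbol{\alpha_{i+1}}$ are connected by a piece of track for all $i=1,\dots,n-1$. In this case, with $\boldsymbol{\gamma_i}=\boldsymbol{\alpha_i}\oplus\boldsymbol{\alpha_{i+1}}$, the track connecting them is $$T((\boldsymbol{\alpha_1},\dots,\boldsymbol{\alpha_n}))=\{\boldsymbol{\alpha_1}\}\cup{}_2\Delta^S(\boldsymbol{\alpha_1})\cup\Big(\bigcup_{i=1}^{n-1}\Delta^S(\boldsymbol{\gamma_i})\Big)\cup{}_1\Delta^S(\boldsymbol{\alpha_n})\cup\{\boldsymbol{\alpha_n}\}.$$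 A track in $S$ is any set arising in this way. *)

(* Defs.v *)
From mathcomp Require Import all_boot.
From mathcomp Require Import boolp classical_sets.

Set Implicit Arguments.
Unset Strict Implicit.
Unset Printing Implicit Defensive.

Local Open Scope classical_set_scope.

(* The index set {1, 2} is [bool]: [true] is index 1, [false] is index 2, and
   the index different from i is [~~ i]. *)
Definition coord (A : Type) (i : bool) (p : A * A) : A := if i then p.1 else p.2.

Definition is_submonoid (S : set (nat * nat)) : Prop :=
  S (0, 0) /\ forall a b, S a -> S b -> S (a.1 + b.1, a.2 + b.2).

Definition good_G1 (S : set (nat * nat)) : Prop :=
  forall a b, S a -> S b -> S (minn a.1 b.1, minn a.2 b.2).

Definition good_G2 (S : set (nat * nat)) : Prop :=
  exists d : nat * nat, forall v : nat * nat, S (d.1 + v.1, d.2 + v.2).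

Definition good_G3 (S : set (nat * nat)) : Prop :=
  forall a b, S a -> S b -> a <> b ->
  forall i, coord i a = coord i b ->
  exists e, [/\ S e,
    coord i a < coord i e,
    minn (coord (~~ i) a) (coord (~~ i) b) <= coord (~~ i) e &
    coord (~~ i) a <> coord (~~ i) b ->
      coord (~~ i) e = minn (coord (~~ i) a) (coord (~~ i) b)].

Definition is_local (S : set (nat * nat)) : Prop :=
  forall a, S a -> a.1 = 0 \/ a.2 = 0 -> a = (0, 0).

Definition good_semigroup (S : set (nat * nat)) : Prop :=
  [/\ is_submonoid S, good_G1 S, good_G2 S, good_G3 S & is_local S].

(* N extended with infinity, which is [None]. *)
Definition enat : Type := option nat.

Definition ele (x y : enat) : bool :=
  match x, y with
  | _, None => true
  | None, Some _ => false
  | Some m, Some n => m <= n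
  end.

Definition elt (x y : enat) : bool := ~~ ele y x.

Definition emin (x y : enat) : enat := if ele x y then x else y.

Definition eadd (x y : enat) : enat :=
  match x, y with
  | Some m, Some n => Some (m + n)
  | _, _ => None
  end.

Definition pt : Type := (enat * enat)%type.

Definition pt_le (a b : pt) : bool := ele a.1 b.1 && ele a.2 b.2.

Definition pt_min (a b : pt) : pt := (emin a.1 b.1, emin a.2 b.2).

Definition pt_add (a b : pt) : pt := (eadd a.1 b.1, eadd a.2 b.2).

Definition emb (p : nat * nat) : pt := (Some p.1, Some p.2).

Definition S1_infty (S : set (nat * nat)) : set pt :=
  [set x | exists a : nat, x = (Some a, None) /\
     exists y0, forall y, y0 <= y -> S (a, y)].

Definition S2_infty (S : set (nat * nat)) : set pt :=
  [set x | exists b : nat, x = (None, Some b) /\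
     exists x0, forall x, x0 <= x -> S (x, b)].

Definition S_infty (S : set (nat * nat)) : set pt :=
  S1_infty S `|` S2_infty S `|` [set (None, None)].

Definition Gamma (S : set (nat * nat)) : set pt := emb @` S `|` S_infty S.

Definition irreducibles (S : set (nat * nat)) : set pt :=
  [set a | [/\ Gamma S a, a <> emb (0, 0) &
     forall b c, Gamma S b -> Gamma S c -> a = pt_add b c -> a = b \/ a = c]].

(* S is identified with Gamma S, so infinite points count. *)
Definition reducibles (S : set (nat * nat)) : set pt :=
  Gamma S `\` irreducibles S.

(* Delta_i(a), as a set of finite points. Points with a negative coordinate are
   left out: these sets are only ever intersected with S. *)
Definition Delta_i (i : bool) (a : pt) : set pt :=
  emb @` [set b | Some (coord i b) = coord i a /\
                  elt (coord (~~ i) a) (Some (coord (~~ i) b))].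

Definition Delta (a : pt) : set pt := Delta_i true a `|` Delta_i false a.

(* _iDelta(a). For infinite a the same formula gives the usual conventions:
   _1Delta((x, oo)) is the whole column x, _2Delta((oo, y)) the whole row y, and
   _2Delta((x, oo)) and _1Delta((oo, y)) are empty. *)
Definition lDelta_i (i : bool) (a : pt) : set pt :=
  emb @` [set b | Some (coord i b) = coord i a /\
                  elt (Some (coord (~~ i) b)) (coord (~~ i) a)].

(* The superscript S: intersection with S, identified with Gamma S. *)
Definition DeltaS (S : set (nat * nat)) (a : pt) : set pt :=
  Delta a `&` Gamma S.

Definition lDeltaS_i (S : set (nat * nat)) (i : bool) (a : pt) : set pt :=
  lDelta_i i a `&` Gamma S.

Definition absolutes (S : set (nat * nat)) : set pt :=
  [set a | S_infty S a \/ ((emb @` S) a /\ DeltaS S a = set0)].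

Definition irr_absolutes (S : set (nat * nat)) : set pt :=
  irreducibles S `&` absolutes S.

Definition piece_of_track (S : set (nat * nat)) (a b : pt) : Prop :=
  [/\ irr_absolutes S a, irr_absolutes S b, ~~ pt_le a b, ~~ pt_le b a &
      DeltaS S (pt_min a b) `&` reducibles S = set0].

(* The points are [alpha 1], ..., [alpha n]; other values of [alpha] play no
   role here or in [track]. *)
Definition connected_by_track (S : set (nat * nat)) (n : nat)
    (alpha : nat -> pt) : Prop :=
  [/\ 1 <= n,
      (forall i, 1 <= i <= n -> irr_absolutes S (alpha i)),
      (forall i j, 1 <= i -> i < j -> j <= n -> elt (alpha i).1 (alpha j).1),
      lDeltaS_i S false (alpha 1) `&` reducibles S = set0 /\
      lDeltaS_i S true (alpha n) `&` reducibles S = set0 &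
      forall i, 1 <= i < n -> piece_of_track S (alpha i) (alpha i.+1)].

Definition track (S : set (nat * nat)) (n : nat) (alpha : nat -> pt) : set pt :=
  [set alpha 1] `|` lDeltaS_i S false (alpha 1)
  `|` (\bigcup_(i in [set i | 1 <= i < n])
         DeltaS S (pt_min (alpha i) (alpha i.+1)))
  `|` lDeltaS_i S true (alpha n) `|` [set alpha n].

(* Main.v *)
Require Import Defs.
From mathcomp Require Import all_boot.
From mathcomp Require Import boolp classical_sets.
From mathcomp Require Import zify.

(* A track consists of irreducible elements, so removing it keeps the set closed
   under sums. It is closed upwards in the columns, and to the right in the rows,
   in which it lies along a column, respectively row, segment, which gives (G1).
   For (G3), with two points in a common column, suppose that the point e of S
   provided by (G3) in the row of the lower one p lies on the track. If e is on a
   row segment, it can be replaced by the left corner of this segment. Otherwise e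
   is strictly below a vertex of the track, and (G3) in S for e and this vertex
   gives a point further right in the row of p. *)

Local Open Scope classical_set_scope.

(** * Coordinates, infinite elements and absolute points *)

Lemma coord_ext (A : Type) i (p q : A * A) :
  coord i p = coord i q -> coord (~~ i) p = coord (~~ i) q -> p = q.
Proof. by case: i p q => [] [? ?] [? ?] /= -> ->. Qed.

Lemma coord_minn i p q :
  coord i (minn p.1 q.1, minn p.2 q.2) = minn (coord i p) (coord i q).
Proof. by case: i. Qed.

Lemma emb_inj : injective emb.
Proof. by move=> [? ?] [? ?] [-> ->]. Qed.

Lemma pt_emb (a : pt) i x y :
  coord i a = Some x -> coord (~~ i) a = Some y ->
  exists p, [/\ a = emb p, coord i p = x & coord (~~ i) p = y].
Proof.
by case: i a => [] [? ?] /= -> ->; [exists (x, y) | exists (y, x)].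
Qed.

Lemma Gamma_emb S p : Gamma S (emb p) -> S p.
Proof.
case=> [[q Sq /emb_inj <-] //|].
by case=> [[[? [//]]|[? [//]]]|//].
Qed.

(** An infinite coordinate stands for all sufficiently large values, so a finite one past any bound
    [N] can replace it. This lets (G1) and (G3), which concern finite points, be applied to infinite
    vertices. *)
Lemma Gamma_truncate S N a : good_semigroup S -> Gamma S a ->
  exists2 q, S q & forall i,
    if coord i a is Some c then coord i q = c else N <= coord i q.
Proof.
move=> [_ _ [d dS] _ _] [[q Sq <-]|]; first by exists q => // -[].
case=> [[[c [-> [y0 Sy]]]|[c [-> [y0 Sy]]]]| ->].
- exists (c, maxn y0 N); first by apply: Sy; lia.
  by case=> //=; lia.
- exists (maxn y0 N, c); first by apply: Sy; lia.
  by case=> //=; lia.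
- exists (d.1 + N, d.2 + N); first exact: (dS (N, N)).
  by case=> /=; lia.
Qed.

(** For finite [a], a point of [S] beyond it on the same line would lie in the empty set
    [DeltaS S a]. An infinite [a] whose coordinate [i] is finite has the other one infinite. *)
Lemma absolute_ge S a i p : absolutes S a -> S p ->
  Some (coord i p) = coord i a ->
  ele (Some (coord (~~ i) p)) (coord (~~ i) a).
Proof.
move=> absa Sp pa; apply: contrapT => /negP ltap.
have [y ay] : exists y, coord (~~ i) a = Some y.
  by case: (coord (~~ i) a) ltap => // y _; exists y.
have [r [ar _ _]] := pt_emb _ _ _ _ (esym pa) ay.
case: absa => [|[_ D0]].
  by rewrite ar; case=> [[[? [//]]|[? [//]]]|//].
suff : DeltaS S a (emb p) by rewrite D0.
split; last by left; exists p.
by case: i pa ltap {ay} => pa ltap; [left|right]; exists p.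
Qed.

(** With d from (G2), the point decomposes as (d.1, oo) + (oo, d.2). *)
Lemma irreducible_not_infty S : good_semigroup S ->
  ~ irreducibles S (None, None).
Proof.
move=> [_ _ [d dS] _ _] [_ _ irr].
have G1 : Gamma S (Some d.1, None).
  right; left; left; exists d.1; split=> //; exists d.2 => y dy.
  by have := dS (0, y - d.2); rewrite /= addn0 subnKC.
have G2 : Gamma S (None, Some d.2).
  right; left; right; exists d.2; split=> //; exists d.1 => x dx.
  by have := dS (x - d.1, 0); rewrite /= addn0 subnKC.
by case: (irr _ _ G1 G2).
Qed.

(** * Removing the staircase of an antichain: the axioms of good semigroups *)

Definition antichain (A : set pt) : Prop :=
  forall a b i, A a -> A b -> elt (coord i a) (coord i b) ->
  elt (coord (~~ i) b) (coord (~~ i) a).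

Definition bounded_by (M : nat) (A : set pt) : Prop :=
  forall a i c, A a -> coord i a = Some c -> c <= M.

(* [staircase S A] will be the set of finite points of the track with vertex set
   [A]. A point in the column of a vertex a belongs to the track exactly when it
   lies strictly above every vertex to the right of a; likewise for rows. This
   form is symmetric in the coordinates and needs no ordering of the vertices. *)
Definition staircase (S : set (nat * nat)) (A : set pt) : set (nat * nat) :=
  [set p | S p /\ exists i a, [/\ A a, Some (coord i p) = coord i a &
     forall b, A b -> elt (Some (coord i p)) (coord i b) ->
       elt (coord (~~ i) b) (Some (coord (~~ i) p))]].

Lemma staircase_ray S A i p q : S q ->
  (exists2 a, A a & Some (coord i p) = coord i a) ->
  (forall b, A b -> elt (Some (coord i p)) (coord i b) ->
       elt (coord (~~ i) b) (Some (coord (~~ i) p))) ->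
  coord i q = coord i p -> coord (~~ i) p <= coord (~~ i) q ->
  staircase S A q.
Proof.
move=> Sq [a Aa pa] pb qp pq; split=> //; exists i, a; split; rewrite ?qp//.
move=> b Ab /(pb b Ab); rewrite /elt /=.
by case: (coord (~~ i) b) => //= c; lia.
Qed.

Lemma staircase_G1 S A : good_G1 S -> good_G1 (S `\` staircase S A).
Proof.
move=> G1 p q [Sp Tp] [Sq Tq]; split; first exact: G1.
move=> [_ [i [a [Aa ma mb]]]].
(* One of [p], [q] shares coordinate [i] with the minimum, so it lies further along the same ray and
   would be removed as well. *)
have [e|e] : coord i p = minn (coord i p) (coord i q) \/
             coord i q = minn (coord i p) (coord i q) by lia.
- apply: Tp; apply: (staircase_ray _ _ i (minn p.1 q.1, minn p.2 q.2) _ Sp) => //; first by exists a.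
    by rewrite coord_minn.
  by rewrite coord_minn; lia.
- apply: Tq; apply: (staircase_ray _ _ i (minn p.1 q.1, minn p.2 q.2) _ Sq) => //; first by exists a.
    by rewrite coord_minn.
  by rewrite coord_minn; lia.
Qed.

Lemma staircase_bounded S A M p : bounded_by M A -> staircase S A p ->
  exists i, coord i p <= M.
Proof. by move=> AM [_ [i [a [Aa pa _]]]]; exists i; exact: AM Aa (esym pa). Qed.

Lemma staircase_G2 S A M : bounded_by M A -> good_G2 S ->
  good_G2 (S `\` staircase S A).
Proof.
move=> AM [d dS]; exists (d.1 + M.+1, d.2 + M.+1) => v; split.
  by have := dS (M.+1 + v.1, M.+1 + v.2); rewrite /= !addnA.
by move=> /(staircase_bounded _ _ _ _ AM) [[] /=]; lia.
Qed.

Lemma bounded_max (P : nat -> Prop) B n : P n -> (forall m, P m -> m <= B) ->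
  exists2 m, P m & forall k, P k -> k <= m.
Proof.
move=> Pn PB.
have ex : exists n, `[< P n >] by exists n; apply/asboolP.
have ub k : `[< P k >] -> k <= B by move/asboolP/PB.
case: (ex_maxnP ex ub) => m /asboolP Pm max_m.
by exists m => // k Pk; apply/max_m/asboolP.
Qed.

(** As [p] is off the staircase, some vertex above its row is not strictly to its left; as [q] is
    off it too, the rightmost such vertex is not in their common column. Hence the corner below that
    vertex is strictly to the right of [p]. *)
Lemma staircase_G3_row S A i p q e : good_semigroup S -> antichain A ->
  A `<=` Gamma S ->
  (S `\` staircase S A) p -> (S `\` staircase S A) q ->
  coord i p = coord i q -> coord (~~ i) p < coord (~~ i) q ->
  coord i p < coord i e -> coord (~~ i) e = coord (~~ i) p ->
  (exists2 a, A a & Some (coord (~~ i) e) = coord (~~ i) a) ->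
  (forall b, A b -> elt (Some (coord (~~ i) e)) (coord (~~ i) b) ->
       elt (coord i b) (Some (coord i e))) ->
  exists g, [/\ (S `\` staircase S A) g, coord i p < coord i g &
    coord (~~ i) g = coord (~~ i) p].
Proof.
move=> gS anti AG [Sp Tp] [Sq Tq] pq_i pq_j pe ep [a Aa ea] eb.
pose P c := exists b, [/\ A b, elt (Some (coord (~~ i) p)) (coord (~~ i) b),
  coord i b = Some c & coord i p <= c].
have [c0 Pc0] : exists c, P c.
  apply: contrapT => nP; apply: Tp; split=> //; exists (~~ i), a.
  split=> //; first by rewrite -ep.
  move=> b Ab pb; rewrite negbK; apply: contrapT => /negP npb; apply: nP.
  have := eb b Ab; rewrite ep => /(_ pb).
  case bc: (coord i b) npb => [c|//] npb _; exists c, b; split=> //.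
  by move: npb; rewrite negbK /=.
have PB c : P c -> c <= coord i e.
  move=> [b [Ab pb bc _]]; have := eb b Ab; rewrite ep => /(_ pb).
  by rewrite bc /elt /=; lia.
(* Among the vertices above the row of [p] and not to the left of [p], [b] is the
   rightmost; the new point is the corner g = min(a, b) of the track. *)
have [c [b [Ab pb bc pc]] maxc] := bounded_max _ _ _ Pc0 PB.
have ba : elt (coord i b) (coord i a).
  have := anti a b (~~ i) Aa Ab; rewrite negbK -ea ep; exact.
(* If [b] were in the column of [p] and [q], a vertex [d] further right and not below [q] would be
   above the row of [p], against the choice of [b]; so [q] would be on the column segment of [b]. *)
have {}pc : coord i p < c.
  rewrite ltn_neqAle pc andbT; apply/eqP => pceq; apply: Tq; split=> //.
  exists i, b; split=> //; first by rewrite bc -pceq pq_i.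
  move=> d Ad; rewrite -pq_i pceq => cd.
  have := anti b d i Ab Ad; rewrite bc => /(_ cd) db.
  apply: contrapT => /negP nd.
  have pd : elt (Some (coord (~~ i) p)) (coord (~~ i) d).
    by move: nd; rewrite /elt /=; case: (coord (~~ i) d) => //= y; lia.
  have := eb d Ad; rewrite ep => /(_ pd).
  case dx: (coord i d) => [x|//] _; move: cd; rewrite dx /elt /= => cx.
  suff : x <= c by lia.
  by apply: maxc; exists d; split=> //; lia.
(* The truncation bounds are such that replacing infinite coordinates does not change the
   minimum. *)
have [ra Sra ra_] := Gamma_truncate S c _ gS (AG a Aa).
have [rb Srb rb_] := Gamma_truncate S (coord (~~ i) p) _ gS (AG b Ab).
have [_ G1 _ _ _] := gS.
set g := (minn ra.1 rb.1, minn ra.2 rb.2).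
have gi : coord i g = c.
  rewrite coord_minn; have := ra_ i; have := rb_ i; rewrite bc => ->.
  by move: ba; rewrite bc /elt; case: (coord i a) => [x|] /=; lia.
have gj : coord (~~ i) g = coord (~~ i) p.
  rewrite coord_minn; have := ra_ (~~ i); have := rb_ (~~ i).
  rewrite -ea ep => rbE ->.
  by move: pb rbE; rewrite /elt; case: (coord (~~ i) b) => [x|] /=; lia.
exists g; split; [split|by rewrite gi|by []]; first exact: G1.
(* A corner is off the staircase: in a column it fails to be strictly above [a], in a row it fails
   to be strictly to the right of [b]. *)
move=> [_ [k [a' [_ _ gb]]]].
have [ki|ki] : k = i \/ k = ~~ i by case: (k) (i) => [] [] /=; auto.
- have := gb a Aa; rewrite ki gi -bc => /(_ ba).
  by rewrite gj -ea ep /elt /= leqnn.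
- have := gb b Ab; rewrite ki gj negbK => /(_ pb).
  by rewrite gi bc /elt /= leqnn.
Qed.

Lemma staircase_G3_lt S A M i p q : good_semigroup S -> antichain A ->
  A `<=` Gamma S -> A `<=` absolutes S -> bounded_by M A ->
  (S `\` staircase S A) p -> (S `\` staircase S A) q ->
  coord i p = coord i q -> coord (~~ i) p < coord (~~ i) q ->
  exists g, [/\ (S `\` staircase S A) g, coord i p < coord i g &
    coord (~~ i) g = coord (~~ i) p].
Proof.
move=> gS anti AG Aabs AM Sp Sq pq_i pq_j; have [_ _ _ G3 _] := gS.
have [e [Se pe _ ee]] : exists e, [/\ S e, coord i p < coord i e,
    minn (coord (~~ i) p) (coord (~~ i) q) <= coord (~~ i) e &
    coord (~~ i) p <> coord (~~ i) q ->
      coord (~~ i) e = minn (coord (~~ i) p) (coord (~~ i) q)].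
  apply: G3 => //; [exact: Sp.1|exact: Sq.1|by move=> pq; move: pq_j; rewrite pq; lia].
have {}ee : coord (~~ i) e = coord (~~ i) p by rewrite ee; lia.
(* With [M.+1] instead of [M], the truncated difference still drops when [coord i e] is [M]. *)
have [k Mk] : exists k, M.+1 - coord i e < k by exists (M.+1 - coord i e).+1.
(* If [e] is in the column of a vertex [a] and strictly below [a], then (G3) for
   [e] and [a] moves [e] strictly further along its row; this stops since the
   vertices are bounded. *)
elim: k e Mk Se pe ee => // k IH e Mk Se pe ee.
have [Te|Te] := pselect (staircase S A e); last by exists e.
have row := staircase_G3_row S A i p q e gS anti AG Sp Sq pq_i pq_j pe ee.
have [_ [l [a [Aa ea eb]]]] := Te.
have [li|li] : l = i \/ l = ~~ i by case: (l) (i) => [] [] /=; auto.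
  subst l.
  have eM : coord i e <= M by exact: AM Aa (esym ea).
  have lea := absolute_ge _ _ _ _ (Aabs a Aa) Se ea.
  (* In case of equality [e] is the vertex [a] itself, which is also in its own row, and the
     antichain condition gives the hypothesis of the row case. *)
  have [aj|aj] := pselect (Some (coord (~~ i) e) = coord (~~ i) a).
    apply: row; first by exists a.
    move=> b Ab; have := anti a b (~~ i) Aa Ab.
    by rewrite negbK -aj -ea.
  have [r Sr r_] := Gamma_truncate S (coord (~~ i) e).+1 _ gS (AG a Aa).
  have ri : coord i r = coord i e by have := r_ i; rewrite -ea.
  have rj : coord (~~ i) e < coord (~~ i) r.
    have := r_ (~~ i); case: (coord (~~ i) a) lea aj => [x|] //= ex nex ->.
    by rewrite ltn_neqAle ex andbT; apply/eqP => exE; apply: nex; rewrite exE.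
  have [f [Sf ef _ ff]] : exists f, [/\ S f, coord i e < coord i f,
      minn (coord (~~ i) e) (coord (~~ i) r) <= coord (~~ i) f &
      coord (~~ i) e <> coord (~~ i) r ->
        coord (~~ i) f = minn (coord (~~ i) e) (coord (~~ i) r)].
    by apply: G3 => // er; move: rj; rewrite er; lia.
  by apply: (IH f) => //; [lia|lia|rewrite ff; lia].
subst l; apply: row; first by exists a.
by move=> b Ab /(eb b Ab); rewrite negbK.
Qed.

Lemma staircase_G3 S A M : good_semigroup S -> antichain A ->
  A `<=` Gamma S -> A `<=` absolutes S -> bounded_by M A ->
  good_G3 (S `\` staircase S A).
Proof.
move=> gS anti AG Aabs AM p q Sp Sq pq i pqi.
case: (ltngtP (coord (~~ i) p) (coord (~~ i) q)) => [lt|lt|pqj].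
- have [g [Sg pg gp]] :=
    staircase_G3_lt _ _ _ _ _ _ gS anti AG Aabs AM Sp Sq pqi lt.
  by exists g; split=> //; lia.
- have [g [Sg qg gq]] :=
    staircase_G3_lt _ _ _ _ _ _ gS anti AG Aabs AM Sq Sp (esym pqi) lt.
  by exists g; split=> //; lia.
- by case: pq; apply: (coord_ext _ i).
Qed.

(** A removed sum of two remaining points would equal one of them by irreducibility; 0 remains since
    it is not irreducible. *)
Lemma remove_irreducibles_submonoid S T : is_submonoid S ->
  emb @` T `<=` irreducibles S -> is_submonoid (S `\` T).
Proof.
move=> [S0 SD] Tirr; split.
  split=> // T0; have [] // : irreducibles S (emb (0, 0)).
  by apply: Tirr; exists (0, 0).
move=> a b [Sa Ta] [Sb Tb]; split; first exact: SD.
move=> Tab; have [_ _ irr] : irreducibles S (emb (a.1 + b.1, a.2 + b.2)).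
  by apply: Tirr; exists (a.1 + b.1, a.2 + b.2).
have Ga : Gamma S (emb a) by left; exists a.
have Gb : Gamma S (emb b) by left; exists b.
by case: (irr _ _ Ga Gb erefl) => /emb_inj ab; [apply: Ta|apply: Tb]; rewrite -ab.
Qed.

Lemma remove_staircase_good S A M : good_semigroup S -> antichain A ->
  A `<=` irr_absolutes S -> bounded_by M A ->
  emb @` staircase S A `<=` irreducibles S ->
  good_semigroup (S `\` staircase S A).
Proof.
move=> gS anti Airr AM Tirr; have [mS G1 G2 G3 loc] := gS; split.
- exact: remove_irreducibles_submonoid.
- exact: staircase_G1.
- exact: staircase_G2 AM G2.
- apply: (staircase_G3 _ _ M) => // a /Airr [] //.
  by case.
- by move=> a [Sa _]; apply: loc.
Qed.

(* [q] truncates [a]: an infinite coordinate is replaced by one beyond the bound. *)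
Lemma staircase_infinite S A M a i q : antichain A -> bounded_by M A ->
  A a -> S q -> Some (coord i q) = coord i a ->
  (if coord (~~ i) a is Some c then coord (~~ i) q = c
   else M < coord (~~ i) q) ->
  staircase S A q.
Proof.
move=> anti AM Aa Sq qa qj; split=> //; exists i, a; split=> // b Ab.
rewrite qa => /(anti _ _ _ Aa Ab).
case ay: (coord (~~ i) a) qj => [y|] /= => [-> //|Mq].
case bx: (coord (~~ i) b) => [x|] // _.
by have := AM b (~~ i) x Ab bx; rewrite /elt /=; lia.
Qed.

(** Needed for strict inclusion: even if all vertices are infinite, truncating one past [M] gives a
    finite point that is removed. *)
Lemma staircase_nonempty S A M : good_semigroup S -> antichain A ->
  A `<=` irr_absolutes S -> bounded_by M A -> A !=set0 ->
  staircase S A !=set0.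
Proof.
move=> gS anti Airr AM [a Aa].
have [[Ga _ _] _] := Airr _ Aa.
have [q Sq q_] := Gamma_truncate S M.+1 _ gS Ga.
have [i [c ac]] : exists i c, coord i a = Some c.
  case E: a => [[x|] [y|]].
  - by exists true, x.
  - by exists true, x.
  - by exists false, y.
  - by have /irreducible_not_infty [] // : irreducibles S (None, None);
    rewrite -E; case: (Airr _ Aa).
exists q; apply: (staircase_infinite _ _ M a i) => //.
  by have := q_ i; rewrite ac => ->.
exact: q_.
Qed.

(** * Infinite elements after the removal *)

Definition finite_pt (x : pt) : Prop := exists p, x = emb p.

Lemma Gamma_infinite S i x : coord (~~ i) x = None ->
  forall c, coord i x = Some c ->
  Gamma S x <-> exists y0, forall p, coord i p = c -> y0 <= coord (~~ i) p -> S p.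
Proof.
case: i x => [] [x1 x2] /= -> c ->; split.
- case=> [[? _ [//]]|]; case=> [[[? [[<-] [y0 H]]]|[? [//]]]|//].
  by exists y0 => -[? y] /= -> /H.
- move=> [y0 H]; right; left; left; exists c; split=> //; exists y0 => y ?.
  exact: H.
- case=> [[? _ [//]]|]; case=> [[[? [//]]|[? [[<-] [y0 H]]]]|//].
  by exists y0 => -[y ?] /= -> /H.
- move=> [y0 H]; right; left; right; exists c; split=> //; exists y0 => y ?.
  exact: H.
Qed.

(** If [x] is a vertex, all points of [S] far out on its line are removed. Otherwise none past [M]
    is: they are on no crossing line of a vertex, and a finite vertex on their own line would be
    absolute, hence beyond them, against the bound. *)
Lemma Gamma_remove_staircase_infinite S A M i c x : good_semigroup S ->
  antichain A -> A `<=` irr_absolutes S -> bounded_by M A ->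
  coord i x = Some c -> coord (~~ i) x = None ->
  Gamma (S `\` staircase S A) x <-> Gamma S x /\ ~ A x.
Proof.
move=> gS anti Airr AM xi xj.
rewrite !(Gamma_infinite _ i x xj c xi); split.
  move=> [y0 H]; split; first by exists y0 => p pc /H [].
  move=> Ax.
  have [p [pi pj]] : exists p, coord i p = c /\ coord (~~ i) p = maxn y0 M.+1.
    by case: (i); [exists (c, maxn y0 M.+1)|exists (maxn y0 M.+1, c)].
  have [|Sp []] := H p pi; first by lia.
  by apply: (staircase_infinite _ _ M x i) => //; rewrite ?pi ?xi ?xj//; lia.
move=> [[y0 H] nAx]; exists (maxn y0 M.+1) => p pi pj.
have Sp : S p by apply: H => //; lia.
split=> // -[_ [k [a [Aa pa _]]]].
have [ki|ki] : k = i \/ k = ~~ i by case: (k) (i) => [] [] /=; auto.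
  subst k; have [_ absa] := Airr _ Aa.
  have := absolute_ge _ _ _ _ absa Sp pa.
  case ay: (coord (~~ i) a) => [y|] /=.
    by have := AM a (~~ i) y Aa ay; lia.
  move=> _; apply: nAx; suff -> : x = a by [].
  by apply: (coord_ext _ i); rewrite ?xj ?ay// xi -pa pi.
subst k; have := AM a _ _ Aa (esym pa); lia.
Qed.

(** Only infinite vertices have to be listed separately, since finite vertices are on the staircase.
    The point (oo, oo) always remains, not being irreducible. *)
Lemma Gamma_remove_staircase S A M x : good_semigroup S ->
  antichain A -> A `<=` irr_absolutes S -> bounded_by M A ->
  Gamma (S `\` staircase S A) x <->
  Gamma S x /\ ~ ((emb @` staircase S A) x \/ A x /\ ~ finite_pt x).
Proof.
move=> gS anti Airr AM; case: x => [[x|] [y|]].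
- split.
    move=> /(Gamma_emb _ (x, y)) [Sp Tp]; split; first by left; exists (x, y).
    by case=> [[q Tq /(emb_inj q (x, y)) qE]|[_ []]];
       [apply: Tp; rewrite -qE|exists (x, y)].
  move=> [/(Gamma_emb _ (x, y)) Sp nT]; left; exists (x, y) => //; split=> //.
  by move=> Tp; apply: nT; left; exists (x, y).
- rewrite (Gamma_remove_staircase_infinite _ _ M true x)//.
  split=> -[G nA]; split=> //.
    by case=> [[? _ //]|[]].
  by move=> Ax; apply: nA; right; split=> // -[].
- rewrite (Gamma_remove_staircase_infinite _ _ M false y)//.
  split=> -[G nA]; split=> //.
    by case=> [[? _ //]|[]].
  by move=> Ax; apply: nA; right; split=> // -[].
- split; last by move=> _; right; right.
  move=> _; split; first by right; right.
  case=> [[? _ //]|[/Airr [irr _] _]].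
  exact: (irreducible_not_infty _ gS irr).
Qed.

(** * The track as the staircase of its vertices *)

Definition vertices n (alpha : nat -> pt) : set pt :=
  alpha @` [set k | 1 <= k <= n].

Lemma elt_trans x y z : elt x y -> elt y z -> elt x z.
Proof. by rewrite /elt; case: x y z => [x|] [y|] [z|] //=; lia. Qed.

Lemma elt_finite x y : elt x y -> exists c, x = Some c.
Proof. by case: x y => [c|] [y|] //=; exists c. Qed.

Lemma elt_irr x : elt x x = false.
Proof. by rewrite /elt; case: x => //= x; rewrite leqnn. Qed.

Lemma elt_ele x y : elt x y -> ele x y.
Proof. by rewrite /elt; case: x y => [x|] [y|] //=; lia. Qed.

Lemma emin_l x y : ele x y -> emin x y = x.
Proof. by rewrite /emin => ->. Qed.

Lemma emin_r x y : elt y x -> emin x y = y.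
Proof. by rewrite /emin /elt => /negbTE ->. Qed.

Lemma ele_elt_or_eq x y : ele x y -> x = y \/ elt x y.
Proof.
rewrite /elt; case: x y => [x|] [y|] //=; auto.
by case: ltngtP => // [_|->]; auto.
Qed.

(** Consecutive vertices are incomparable and their first coordinates increase, so the second ones
    must decrease. *)
Lemma track_snd_decr S n alpha k l : connected_by_track S n alpha ->
  1 <= k -> k < l -> l <= n -> elt (alpha l).2 (alpha k).2.
Proof.
move=> [_ _ incr _ piece] k1; elim: l => // l IH kl ln.
have step : elt (alpha l.+1).2 (alpha l).2.
  have [|_ _ + _ _] := piece l; first by lia.
  by rewrite /pt_le (elt_ele _ _ (incr l l.+1 _ _ _)) //; lia.
have [->//|kl'] : k = l \/ k < l by lia.
by apply: elt_trans step _; apply: IH; lia.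
Qed.

Lemma track_antichain S n alpha : connected_by_track S n alpha ->
  antichain (vertices n alpha).
Proof.
move=> C; have [_ _ incr _ _] := C.
move=> _ _ i [k /andP[k1 kn] <-] [l /andP[l1 ln] <-] lt.
case: (ltngtP k l) => kl; last by rewrite kl elt_irr in lt.
- case: i lt => /= lt; first exact: track_snd_decr C _ _ _.
  by have := elt_trans _ _ _ lt (track_snd_decr _ _ _ _ _ C k1 kl ln); rewrite elt_irr.
- case: i lt => /= lt; last exact: incr.
  by have := elt_trans _ _ _ lt (incr _ _ l1 kl kn); rewrite elt_irr.
Qed.

Lemma vertices_bounded n alpha : exists M, bounded_by M (vertices n alpha).
Proof.
elim: n => [|n [M AM]]; first by exists 0 => a i c [k /= k01]; lia.
(* Infinite coordinates need no bound and contribute 0. *)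
exists (M + (odflt 0 (alpha n.+1).1) + (odflt 0 (alpha n.+1).2)).
move=> _ i c [k /= kn <-] ac.
have [kE|kn'] : k = n.+1 \/ 1 <= k <= n by lia.
  by move: ac; rewrite kE; case: i => /= -> /=; lia.
suff : c <= M by lia.
by apply: (AM (alpha k) i) => //; exists k.
Qed.

(** Among the vertices to the right of [alpha k], the next one is the highest. So in the column of
    [alpha k] the staircase condition amounts to lying strictly above [alpha k.+1], which is the
    column part of [Delta] at the corner; rows are symmetric. *)
Lemma track_emb S n alpha p : connected_by_track S n alpha -> S p ->
  track S n alpha (emb p) <-> staircase S (vertices n alpha) p.
Proof.
move=> C Sp; have [n1 irr incr _ _] := C.
have decr k l := track_snd_decr _ _ _ k l C.
have Gp : Gamma S (emb p) by left; exists p.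
have minE k : 1 <= k < n ->
    pt_min (alpha k) (alpha k.+1) = ((alpha k).1, (alpha k.+1).2).
  move=> kn; rewrite /pt_min emin_l; last by apply/elt_ele/incr; lia.
  by rewrite emin_r //; apply: decr; lia.
have fst_lt k m : 1 <= k <= n -> 1 <= m <= n ->
    elt (alpha k).1 (alpha m).1 -> k < m.
  move=> kn mn lt; rewrite ltnNge; apply/negP => mk.
  have [mkE|mk'] : m = k \/ m < k by lia.
    by rewrite mkE elt_irr in lt.
  have := elt_trans _ _ _ lt (incr m k _ mk' _).
  by rewrite elt_irr => H; suff : false by []; apply: H; lia.
have snd_lt k m : 1 <= k <= n -> 1 <= m <= n ->
    elt (alpha k).2 (alpha m).2 -> m < k.
  move=> kn mn lt; rewrite ltnNge; apply/negP => km.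
  have [mkE|mk'] : m = k \/ k < m by lia.
    by rewrite mkE elt_irr in lt.
  have := elt_trans _ _ _ lt (decr k m _ mk' _).
  by rewrite elt_irr => H; suff : false by []; apply: H; lia.
have column k : 1 <= k <= n -> Some p.1 = (alpha k).1 ->
    (k < n -> elt (alpha k.+1).2 (Some p.2)) ->
    staircase S (vertices n alpha) p.
  move=> kn pk below; split=> //; exists true, (alpha k); split=> //.
    by exists k.
  move=> _ [m mn <-] /=; rewrite pk => /(fst_lt _ _ kn mn) km.
  have lt : elt (alpha k.+1).2 (Some p.2) by apply: below; move: mn => /=; lia.
  have [->//|km'] : m = k.+1 \/ k.+1 < m by lia.
  by apply: elt_trans lt; apply: decr => //; move: mn => /=; lia.
have row k : 1 <= k <= n -> Some p.2 = (alpha k).2 ->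
    (1 < k -> elt (alpha k.-1).1 (Some p.1)) ->
    staircase S (vertices n alpha) p.
  move=> kn pk left_; split=> //; exists false, (alpha k); split=> //.
    by exists k.
  move=> _ [m mn <-] /=; rewrite pk => /(snd_lt _ _ kn mn) mk.
  have lt : elt (alpha k.-1).1 (Some p.1) by apply: left_; move: mn => /=; lia.
  have [->//|mk'] : m = k.-1 \/ m < k.-1 by move: mn => /=; lia.
  by apply: elt_trans lt; apply: incr => //; move: mn => /=; lia.
split.
  case=> [[[[pE|[Dp _]]|[k kn [+ _]]]|[Dp _]]|pE].
  - by apply: (row 1) => //; rewrite -pE.
  - case: Dp => q [qa _] /emb_inj qp; subst q.
    by apply: (row 1).
  - move: kn => /= kn; rewrite minE // => -[] [q [/= qa qb]] /emb_inj qp; subst q.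
      by apply: (column k) => //; lia.
    by apply: (row k.+1) => //; lia.
  - case: Dp => q [qa _] /emb_inj qp; subst q.
    by apply: (column n) => //; lia.
  - by apply: (column n); rewrite -?pE //; lia.
move=> [_ [i [_ [[k kn <-] pk beyond]]]]; move: kn => /= kn.
have absk : absolutes S (alpha k) by have [] := irr k kn.
case: i pk beyond => /= pk beyond.
- have ple := absolute_ge S _ true p absk Sp pk.
  (* No vertex is to the right of [alpha n]; by absoluteness its column contains only points of [S]
     up to [alpha n], and all of them are on the track. *)
  have [kE|kn'] : k = n \/ k < n by lia.
    subst k; case: (ele_elt_or_eq _ _ ple) => /= [pE|lt].
      by right; rewrite /emb pk pE; case: (alpha n).
    by left; right; split=> //; exists p.
  left; left; right; exists k; first by move=> /=; lia.
  split=> //; left; exists p => //; rewrite minE; last by lia.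
  split=> //=.
  apply: beyond; first by exists k.+1 => //=; lia.
  by rewrite pk; apply: incr; lia.
- have ple := absolute_ge S _ false p absk Sp pk.
  have [kE|k1] : k = 1 \/ 1 < k by lia.
    subst k; left; left; left; case: (ele_elt_or_eq _ _ ple) => /= [pE|lt].
      by left; rewrite /emb pk pE; case: (alpha 1).
    by right; split=> //; exists p.
  left; left; right; exists k.-1; first by move=> /=; lia.
  split=> //; right; exists p => //; rewrite minE ?prednK; try lia.
  split=> //=.
  apply: beyond; first by exists k.-1 => //=; lia.
  by rewrite pk; apply: decr; lia.
Qed.

Lemma track_irreducible S n alpha : connected_by_track S n alpha ->
  track S n alpha `<=` irreducibles S.
Proof.
move=> [n1 irr _ [row1 coln] piece].
have avoid (B : set pt) : B `<=` Gamma S -> B `&` reducibles S = set0 ->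
    B `<=` irreducibles S.
  move=> BG B0 x Bx; apply: contrapT => nx.
  suff : (B `&` reducibles S) x by rewrite B0.
  by split=> //; split=> //; apply: BG.
move=> x [[[[->|]|[k kn]]|]|->].
- by case: (irr 1) => //; lia.
- by apply: (avoid _ _ row1) => y [].
- by case: (piece k kn) => _ _ _ _ B0; apply: (avoid _ _ B0) => y [].
- by apply: (avoid _ _ coln) => y [].
- by case: (irr n) => //; lia.
Qed.

(** All [Delta] pieces consist of finite points, so only the end vertices can be infinite points of
    the track. An inner vertex is finite, each coordinate being strictly below that of a
    neighbour. *)
Lemma track_infinite S n alpha x : good_semigroup S ->
  connected_by_track S n alpha -> ~ finite_pt x ->
  track S n alpha x <-> vertices n alpha x.
Proof.
move=> gS C nfx; have [n1 irr incr _ _] := C.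
have decr k l := track_snd_decr _ _ _ k l C.
split.
  case=> [[[[->|[[q _ qx] _]]|[k _ [+ _]]]|[[q _ qx] _]]| ->].
  - by exists 1 => //=; lia.
  - by case: nfx; exists q.
  - by case=> -[q _ qx]; case: nfx; exists q.
  - by case: nfx; exists q.
  - by exists n => //=; lia.
move=> [k kn xk]; move: kn => /= kn.
have [k1|k1] : k = 1 \/ 1 < k by lia.
  by left; left; left; left; rewrite -xk k1.
have [kE|kn'] : k = n \/ k < n by lia.
  by right; rewrite -xk kE.
have x1 : elt x.1 (alpha k.+1).1 by rewrite -xk; apply: incr; lia.
have x2 : elt x.2 (alpha k.-1).2 by rewrite -xk; apply: decr; lia.
have [a xa] := elt_finite _ _ x1; have [b xb] := elt_finite _ _ x2.
by case: nfx; exists (a, b); case: x {xk x1 x2} xa xb => ? ? /= -> ->.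
Qed.

Theorem lemma21 :
  forall (S : set (nat * nat)) (n : nat) (alpha : nat -> pt),
    good_semigroup S ->
    connected_by_track S n alpha ->
    exists S' : set (nat * nat),
      [/\ good_semigroup S', S' `<` S & Gamma S' = Gamma S `\` track S n alpha].
Proof.
move=> S n alpha gS C; have [n1 irr _ _ _] := C.
set A := vertices n alpha.
have [M AM] : exists M, bounded_by M A by exact: vertices_bounded.
have anti : antichain A by exact: track_antichain C.
have Airr : A `<=` irr_absolutes S by move=> _ [k kn <-]; apply: irr.
have Tirr : emb @` staircase S A `<=` irreducibles S.
  move=> _ [p Tp <-]; apply: (track_irreducible _ _ _ C).
  by apply/track_emb => //; case: Tp.
have trackE x : Gamma S x -> track S n alpha x <->
    (emb @` staircase S A) x \/ A x /\ ~ finite_pt x.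
  move=> Gx; have [[p xp]|nfx] := pselect (finite_pt x).
    move: Gx; rewrite xp => /Gamma_emb Sp; rewrite (track_emb _ _ _ _ C Sp).
    split=> [Tp|[[q Tq /emb_inj <-] //|[_ []]]]; last by exists p.
    by left; exists p.
  rewrite (track_infinite _ _ _ _ gS C nfx); split=> [Ax|]; first by right.
  by case=> [[q _ qx]|[]//]; case: nfx; exists q.
exists (S `\` staircase S A); split.
- exact: remove_staircase_good AM Tirr.
- split; first by move=> p [].
  have [|q Tq] := staircase_nonempty _ _ _ gS anti Airr AM.
    by exists (alpha 1); exists 1 => //=; lia.
  by move=> /(_ q) [|_ []//]; case: Tq.
- apply/seteqP; split=> x.
    move=> /(Gamma_remove_staircase _ _ _ _ gS anti Airr AM) [Gx nT].
    by split=> // /(trackE _ Gx).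
  move=> [Gx nT]; apply/(Gamma_remove_staircase _ _ _ _ gS anti Airr AM).
  by split=> // /(trackE _ Gx).
Qed.
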